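(* Let $R_0>0$, $T>0$, $\lambda_n=(n\pi/R_0)^2$ for $n\ge1$, let $a:[0,T]\to\mathbb{R}$ satisfy $0<a_0\le a(t)\le a_1$, and let $B^H$ be a fractional Brownian motion with Hurst index $H\in(0,1)$. If $h\in L^\infty(0,T)$ is nonnegative and its support has positive measure, then there is a constant $C>0$ independent of $n$ such that for all $n\ge1$ $$\Big|\int_0^T h(\tau)e^{-\lambda_n\int_\tau^T a(s)ds}\,d\tau\Big|\le \frac{C}{\lambda_n},\qquad \mathbb{E}\Big[\Big(\int_0^T e^{-\lambda_n\int_\tau^T a(s)ds}\,dB^H(\tau)\Big)^2\Big]\le\frac{C}{\lambda_n^{p}},$$ where $p=\min\{2H,1\}$.
   Context: A fractional Brownian motion $B^H$ is a centered Gaussian process with $B^H(0)=0$ and covariance $\mathbb{E}[B^H(t)B^H(s)]=\frac12(t^{2H}+s^{2H}-|t-s|^{2H})$; the stochastic integral of a deterministic integrand is the Wiener integral with respect to $B^H$. (These quantities are the factors relating $f_n,g_n^2$ to $\mathbb{E}(u_n(T))$ and $\mathbb{V}(u_n(T))$ for the final-time Fourier coefficients of the solution of $u_t=a(t)[u_{rr}+\frac2r u_r]+f(r)h(t)+g(r)\dot B^H(t)$ on a ball of radius $R_0$; their decay expresses ill-posedness of recovering $f$ and $|g|$.) *)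

(* Defs.v *)
From HB Require Import structures.
From mathcomp Require Import all_boot all_order all_algebra.
From mathcomp Require Import all_classical all_reals all_analysis.
Set Implicit Arguments. Unset Strict Implicit. Unset Printing Implicit Defensive.
Import Order.TTheory GRing.Theory Num.Theory.
Import numFieldNormedType.Exports.
Local Open Scope classical_set_scope.
Local Open Scope ring_scope.

Section defs.
Context {R : realType} {d : measure_display} {Omega : measurableType d}.

Definition fbm_cov (H t s : R) : R :=
  (t `^ (2 * H) + s `^ (2 * H) - `|t - s| `^ (2 * H)) / 2.

Definition centered_gaussian (P : probability Omega R) (X : Omega -> R) (v : R) :=
  if v == 0 then P [set w | X w != 0] = 0%E
  else forall A : set R, measurable A ->
         P (X @^-1` A) = normal_prob 0 (Num.sqrt v) A.

(* B is a fractional Brownian motion with Hurst index H on [0, +oo):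
   a centered Gaussian process (every finite linear combination of the
   B t, t >= 0, is centered Gaussian) with the fBm covariance. B(0) = 0
   a.s. follows since fbm_cov H 0 0 = 0. *)
Definition is_fBm (P : probability Omega R) (H : R) (B : R -> Omega -> R) :=
  (forall t, measurable_fun setT (B t)) /\
  (forall s : seq (R * R), all (fun p => 0 <= p.2) s ->
     centered_gaussian P (fun w => \sum_(p <- s) p.1 * B p.2 w)
       (\sum_(p <- s) \sum_(q <- s) p.1 * q.1 * fbm_cov H p.2 q.2)).

Definition riemann_sum_dB (B : R -> Omega -> R) (f : R -> R) (T : R) (N : nat)
  (w : Omega) : R :=
  \sum_(i < N) f (i%:R * T / N%:R) *
     (B (i.+1%:R * T / N%:R) w - B (i%:R * T / N%:R) w).

(* X is the Wiener integral \int_0^T f dB (for the continuous deterministic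
   integrands considered here): the L^2(P)-limit of the Riemann sums *)
Definition is_wiener_integral (P : probability Omega R) (B : R -> Omega -> R)
  (f : R -> R) (T : R) (X : Omega -> R) :=
  measurable_fun setT X /\
  forall e : R, 0 < e -> exists N0 : nat, forall N : nat, (N0 <= N)%N ->
    (\int[P]_w (((X w - riemann_sum_dB B f T N w) ^+ 2)%:E) <= e%:E)%E.

End defs.

(* Main.v *)
Require Import Defs.
From HB Require Import structures.
From mathcomp Require Import all_boot all_order all_algebra.
From mathcomp Require Import all_classical all_reals all_analysis.
From mathcomp Require Import measurable_realfun ring lra.
Set Implicit Arguments. Unset Strict Implicit. Unset Printing Implicit Defensive.
Import Order.TTheory GRing.Theory Num.Theory.
Import numFieldNormedType.Exports.
Local Open Scope classical_set_scope.
Local Open Scope ring_scope.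

(** The weight [f] of the Wiener integral is nonnegative, nondecreasing and at
    most [exp (- c (T - t))] with [c = lambda_n a0].  Abel summation turns a
    Riemann sum of [f dB] into a combination with nonnegative coefficients of
    the tails [B T - B t_i], whose covariances are at most the products of
    [(T - t_i)^H].  A second Abel summation then bounds the standard deviation by
    [sum f(t_i) ((T - t_i)^H - (T - t_(i+1))^H)], which is a lower sum of an
    exponential integral, of order [c^(-H)] uniformly in the mesh.  Hence the
    second moment is [O(lambda_n^(-2H))], for every [H]; the exponent
    [min (2H) 1] is weaker because [lambda_n >= lambda_1]. *)

(** * Powers and sums *)

(** For [0 < z <= x + y] the ratio [z / (x + y)] is at most 1, so raising it to a power [r <= 1]
    does not decrease it. Apply this to [z = x] and [z = y]: the two ratios add up to 1. *)
Lemma powR_subadditive (R : realType) (r x y : R) : 0 < r <= 1 -> 0 <= x -> 0 <= y ->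
  (x + y) `^ r <= x `^ r + y `^ r.
Proof.
move=> /andP[r0 r1]; rewrite le_eqVlt => /predU1P[<- _|x0].
  by rewrite add0r lerDr powR_ge0.
rewrite le_eqVlt => /predU1P[<-|y0]; first by rewrite addr0 lerDl powR_ge0.
have s0 : 0 < x + y by rewrite addr_gt0.
have frac z : 0 < z -> z <= x + y -> (x + y) `^ r * (z / (x + y)) <= z `^ r.
  move=> z0 zs; rewrite -[z in leRHS](divfK (lt0r_neq0 s0)) mulrC.
  have zs0 : 0 <= z / (x + y) by rewrite divr_ge0 ?ltW.
  rewrite (powRM _ zs0 (ltW s0)) ler_wpM2r ?powR_ge0//.
  by apply: ger1_powR => //; rewrite divr_gt0//= ler_pdivrMr// mul1r.
have xs : x <= x + y by rewrite lerDl ltW.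
have ys : y <= x + y by rewrite lerDr ltW.
apply: le_trans (lerD (frac _ x0 xs) (frac _ y0 ys)).
by rewrite -mulrDr -mulrDl divff ?mulr1// gt_eqF.
Qed.

Lemma powR_dist_le (R : realType) (r x y : R) : 0 < r <= 1 -> 0 <= x -> 0 <= y ->
  `|x `^ r - y `^ r| <= `|x - y| `^ r.
Proof.
move=> r01; wlog xy : x y / y <= x => [hw x0 y0|_ y0].
  have [/hw|/ltW/hw] := leP y x; first exact.
  by rewrite distrC [`|y - x|]distrC; exact.
have/andP[r0 _] := r01; rewrite (@ger0_norm _ (x - y)) ?subr_ge0//.
have yx : y `^ r <= x `^ r.
  by apply: ge0_ler_powR => //; [exact: ltW|rewrite nnegrE (le_trans y0)].
rewrite ger0_norm ?subr_ge0//.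
rewrite lerBlDr; apply: le_trans (_ : (x - y + y) `^ r <= _).
  by rewrite subrK.
apply: powR_subadditive => //.
by rewrite subr_ge0.
Qed.

(** The left-hand side is the covariance of [B T - B s] and [B T - B t]. It equals half of [(T -
    s)^(2H) + (T - t)^(2H) - |s - t|^(2H)], and squaring the Hölder bound [|x^H - y^H| <= |x - y|^H]
    at [x = T - s], [y = T - t] bounds this by the product. *)
Lemma fbm_cov_tail_le (R : realType) (H T s t : R) : 0 < H <= 1 -> s <= T -> t <= T ->
  fbm_cov H T T - fbm_cov H T t - fbm_cov H s T + fbm_cov H s t <=
  (T - s) `^ H * (T - t) `^ H.
Proof.
move=> H01 sT tT; have /andP[H0 _] := H01.
have sq z : 0 <= z -> z `^ (2 * H) = (z `^ H) ^+ 2.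
  by move=> z0; rewrite mulrC powRrM -powR_mulrn ?powR_ge0.
have := powR_dist_le H01 (_ : 0 <= T - s) (_ : 0 <= T - t).
rewrite !subr_ge0 => /(_ sT tT) dist.
have {dist} : (T - s) `^ H ^+ 2 + (T - t) `^ H ^+ 2 - `|s - t| `^ H ^+ 2 <=
    (T - s) `^ H * (T - t) `^ H *+ 2.
  have -> : `|s - t| = `|T - s - (T - t)| by rewrite distrC; congr `|_|; ring.
  have := lerXn2r 2 (normr_ge0 _ : _ \in Num.nneg) (powR_ge0 _ _ : _ \in Num.nneg) dist.
  rewrite real_normK ?num_real// sqrrB; lra.
rewrite /fbm_cov subrr normr0 powR0 ?mulf_neq0 ?gt_eqF//.
rewrite (@ger0_norm _ (T - t)) ?subr_ge0// (distrC s T) (@ger0_norm _ (T - s)) ?subr_ge0//.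
rewrite !(sq (T - _)) ?subr_ge0// (sq `|_|)//; lra.
Qed.

(** Backward difference with the convention that [f] vanishes before index 0, so partial sums
    telescope to [f n] without a boundary term. *)
Definition bdiff {V : zmodType} (f : nat -> V) (i : nat) : V :=
  f i - (if i is j.+1 then f j else 0).

Lemma sum_bdiff (V : zmodType) (f : nat -> V) n : \sum_(i < n.+1) bdiff f i = f n.
Proof.
elim: n => [|n IHn]; first by rewrite big_ord1 /bdiff subr0.
by rewrite big_ord_recr IHn /bdiff /= addrC subrK.
Qed.

Lemma abel_summation (R : comPzRingType) (f b : nat -> R) n :
  \sum_(i < n) f i * (b i.+1 - b i) = \sum_(i < n) bdiff f i * (b n - b i).
Proof.
elim: n => [|n IHn]; first by rewrite !big_ord0.
rewrite big_ord_recr /= IHn -[in LHS](sum_bdiff f n) mulr_suml.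
rewrite [X in _ + X]big_ord_recr [RHS]big_ord_recr /= addrA -big_split /=.
by congr (_ + _); apply: eq_bigr => i _; rewrite -mulrDr addrC addrA subrK.
Qed.

(* [z^H <= 1 + z] gives [exp (- z) <= exp (1 - z^H)], and the right-hand side,
   as a function of [z^H], telescopes. *)
Lemma expR_powR_decay (R : realType) (H c x y : R) : 0 < H <= 1 -> 0 <= c ->
  0 <= y <= x ->
  c `^ H * (expR (- (c * x)) * (x `^ H - y `^ H)) <=
  expR (1 - (c * y) `^ H) - expR (1 - (c * x) `^ H).
Proof.
move=> /andP[H0 H1] c0 /andP[y0 yx]; have x0 := le_trans y0 yx.
rewrite mulrCA mulrBr -!powRM//.
set u := (c * x) `^ H; set v := (c * y) `^ H.
have vu : 0 <= u - v.
  rewrite subr_ge0; apply: ge0_ler_powR; rewrite ?nnegrE ?mulr_ge0 ?ler_wpM2l//.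
  exact: ltW.
have ux : u <= 1 + c * x.
  have [cx1|/ltW cx1] := leP 1 (c * x); first by rewrite (le_trans (ler1_powR cx1 H1))// lerDr.
  apply: (@le_trans _ _ 1); last by rewrite lerDl mulr_ge0.
  have -> : 1 = 1 `^ H :> R by rewrite powR1.
  apply: ge0_ler_powR; rewrite ?nnegrE ?mulr_ge0//.
  exact: ltW.
apply: (@le_trans _ _ (expR (1 - u) * (u - v))).
  by rewrite ler_wpM2r// ler_expR; lra.
have -> : 1 - v = 1 - u + (u - v) by ring.
rewrite (expRD (1 - u)) lerBrDl; set g := expR (1 - u); rewrite -{1}[g]mulr1 -mulrDr.
by rewrite ler_wpM2l ?expR_ge0 ?expR_ge1Dx.
Qed.

(** The termwise bounds telescope to a difference of two exponentials, the larger at most [expR 1].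
    The result depends neither on [n] nor on the partition [u], hence the uniformity in the mesh. *)
Lemma sum_expR_powR_le (R : realType) (H c : R) (u : nat -> R) n : 0 < H <= 1 -> 0 < c ->
  (forall i, (i <= n)%N -> 0 <= u i) -> (forall i, (i < n)%N -> u i.+1 <= u i) ->
  \sum_(i < n) expR (- (c * u i)) * (u i `^ H - u i.+1 `^ H) <= expR 1 / c `^ H.
Proof.
move=> H01 c0 u0 udec; rewrite ler_pdivlMr ?powR_gt0// mulrC mulr_sumr.
pose g i := expR (1 - (c * u i) `^ H).
apply: (@le_trans _ _ (\sum_(i < n) (g i.+1 - g i))).
  apply: ler_sum => i _; apply: expR_powR_decay => //; first exact: ltW.
  by rewrite u0 ?udec.
rewrite -(big_mkord xpredT (fun i => g i.+1 - g i)) telescope_sumr//.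
rewrite lerBlDr (@le_trans _ _ (expR 1))// ?lerDl ?expR_ge0//.
by rewrite ler_expR gerBl powR_ge0.
Qed.

(** * Second moments of Gaussian variables *)

Section density.
Context d (T : measurableType d) (R : realType).
Variables (mu nu : {measure set T -> \bar R}) (g : T -> R).
Hypothesis mg : measurable_fun setT g.
Hypothesis g0 : forall x, 0 <= g x.
Hypothesis nuE : forall A, measurable A -> nu A = (\int[mu]_(x in A) (g x)%:E)%E.
Local Open Scope ereal_scope.
Import HBNNSimple.

Lemma integral_density_nnsfun (f : {nnsfun T >-> R}) :
  \int[nu]_x (f x)%:E = \int[mu]_x ((f x)%:E * (g x)%:E).
Proof.
under [LHS]eq_integral do rewrite fimfunE -fsumEFin//.
rewrite [LHS]ge0_integral_fsum//; last 2 first.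
  - by move=> r; exact/measurable_EFinP/measurableT_comp.
  - by move=> n x _; rewrite EFinM nnfun_muleindic_ge0.
under [RHS]eq_integral.
  move=> x xD; rewrite fimfunE -fsumEFin// muleC ge0_mule_fsumr; last first.
    by move=> r; rewrite EFinM nnfun_muleindic_ge0.
  over.
have mfg r : measurable_fun setT
    (fun x => (g x)%:E * (r * \1_(f @^-1` [set r]) x)%:E).
  by apply: emeasurable_funM; apply/measurable_EFinP => //; exact: measurableT_comp.
rewrite [RHS]ge0_integral_fsum//; last first.
  move=> n x _; rewrite mule_ge0//; first by rewrite lee_fin.
  by rewrite EFinM nnfun_muleindic_ge0.
apply: eq_fsbigr => r; rewrite inE => -[t _ <-].
rewrite integralZl_indic_nnsfun//= integral_indic// setIT nuE//.
under [RHS]eq_integral do rewrite EFinM muleCA.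
rewrite ge0_integralZl//.
- congr (_ * _); rewrite integral_mkcond; apply: eq_integral => x _.
  by rewrite patchE indicE; case: ifPn => _; rewrite ?mule1 ?mule0.
- by apply: emeasurable_funM; apply/measurable_EFinP => //; exact: measurable_indic.
- by move=> x _; rewrite mule_ge0 ?lee_fin.
- by rewrite lee_fin.
Qed.

Lemma ge0_integral_density (f : T -> \bar R) :
  measurable_fun setT f -> (forall x, 0 <= f x) ->
  \int[nu]_x f x = \int[mu]_x (f x * (g x)%:E).
Proof.
move=> mf f0; pose f_ := nnsfun_approx measurableT mf.
have nd x m n : (m <= n)%N -> (f_ m x <= f_ n x)%R.
  by move=> mn; exact/lefP/nd_nnsfun_approx.
transitivity (lim (\int[nu]_x (f_ n x)%:E @[n --> \oo])).
  rewrite -monotone_convergence//=.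
  - apply: eq_integral => x _; apply/esym/cvg_lim => //=.
    exact: cvg_nnsfun_approx.
  - by move=> n; exact/measurable_EFinP/measurable_funTS.
  - by move=> n x _; rewrite lee_fin.
  - by move=> x _ m n mn; rewrite lee_fin nd.
under eq_fun do rewrite integral_density_nnsfun.
rewrite -monotone_convergence//=.
- apply: eq_integral => x _; apply/cvg_lim => //=.
  by apply: cvgeZr => //; exact: cvg_nnsfun_approx.
- by move=> n; apply: emeasurable_funM; exact/measurable_EFinP.
- by move=> n x _; rewrite mule_ge0// lee_fin.
- by move=> x _ m n mn; rewrite lee_wpmul2r ?lee_fin// nd.
Qed.
End density.

(* The constant is not sharp: [x^2] times the density of standard deviation [s]
   is pointwise at most [8 s^2] times the density of standard deviation [2 s]. *)
Lemma integral_sqr_normal_prob_le (R : realType) (s : R) : s != 0 ->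
  (\int[normal_prob 0 s]_x (x ^+ 2)%:E <= (8 * s ^+ 2)%:E)%E.
Proof.
move=> s0.
have s2 : 0 < s ^+ 2 by rewrite exprn_even_gt0.
have msq : measurable_fun setT (fun x : R => x ^+ 2) by exact: measurable_funX.
rewrite (@ge0_integral_density _ _ R lebesgue_measure (normal_prob 0 s)
  _ (measurable_normal_pdf 0 s) (normal_pdf_ge0 0 s))//; last 2 first.
- exact/measurable_EFinP.
- by move=> x; rewrite lee_fin sqr_ge0.
apply: (@le_trans _ _ (\int[lebesgue_measure]_x ((8 * s ^+ 2)%:E * (normal_pdf 0 (2 * s) x)%:E))%E).
  apply: ge0_le_integral => //.
  - by move=> x _; rewrite -EFinM lee_fin mulr_ge0 ?sqr_ge0 ?normal_pdf_ge0.
  - apply: emeasurable_funM; apply/measurable_EFinP => //.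
    exact: measurable_normal_pdf.
  - by apply: emeasurable_funM; apply/measurable_EFinP => //; exact: measurable_normal_pdf.
  move=> x _; rewrite -!EFinM lee_fin !normal_pdfE ?mulf_neq0//.
  have -> : normal_peak (2 * s) = normal_peak s / 2.
    rewrite /normal_peak; have -> : (2 * s) ^+ 2 * pi *+ 2 = 2 ^+ 2 * (s ^+ 2 * pi *+ 2) by ring.
    by rewrite sqrtrM ?sqr_ge0// sqrtr_sqr ger0_norm// invfM mulrC.
  rewrite /normal_fun subr0.
  (* In the variable [z] the two Gaussian exponents become [- 4 z] and [- z], and the pointwise
     comparison reduces to [2 z <= expR (3 z)], which follows from [1 + 3 z <= expR (3 z)]. *)
  set k := normal_peak s; pose z := x ^+ 2 / (8 * s ^+ 2).
  have xz : x ^+ 2 = 8 * s ^+ 2 * z by rewrite /z mulrC divfK// mulf_neq0// gt_eqF.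
  have -> : - x ^+ 2 / (s ^+ 2 *+ 2) = - (4 * z) by rewrite /z; field.
  have -> : - x ^+ 2 / ((2 * s) ^+ 2 *+ 2) = - z by rewrite /z; field.
  have z0 : 0 <= z by rewrite divr_ge0 ?sqr_ge0// mulr_ge0// ltW.
  rewrite xz [leLHS](_ : _ = 8 * s ^+ 2 * k * (z * expR (- (4 * z)))); last by ring.
  rewrite [leRHS](_ : _ = 8 * s ^+ 2 * k * (expR (- z) / 2)); last by field.
  have K0 : 0 <= 8 * s ^+ 2 := mulr_ge0 (ler0n R 8) (ltW s2).
  rewrite (ler_wpM2l (mulr_ge0 K0 (normal_peak_ge0 s))) //.
  have -> : - z = - (4 * z) + 3 * z by ring.
  rewrite expRD -mulrA mulrC ler_wpM2l ?expR_ge0// ler_pdivlMr//.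
  by apply: le_trans (expR_ge1Dx _); lra.
rewrite ge0_integralZl//; last 3 first.
- by apply/measurable_EFinP; exact: measurable_normal_pdf.
- by move=> x _; rewrite lee_fin normal_pdf_ge0.
- by rewrite lee_fin mulr_ge0// ltW.
by rewrite integral_normal_pdf mule1.
Qed.

Lemma centered_gaussian_sqr_le (R : realType) d (Omega : measurableType d)
    (P : probability Omega R) (X : Omega -> R) (v : R) :
  measurable_fun setT X -> 0 <= v -> centered_gaussian P X v ->
  (\int[P]_w (X w ^+ 2)%:E <= (8 * v)%:E)%E.
Proof.
move=> mX v0; rewrite /centered_gaussian; case: eqVneq => [-> PX|vn0 PX].
  rewrite mulr0 (_ : \int[P]_w _ = 0)%E//.
  rewrite -[RHS](@integral0 _ _ _ P setT); apply: ae_eq_integral => //.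
    by apply/measurable_EFinP; exact: measurable_funX.
  exists [set w | X w != 0]; split => //.
    rewrite (_ : [set w | _] = X @^-1` (~` [set 0])).
      by rewrite -[X in measurable X]setTI; apply: mX => //; exact: measurableC.
    by apply/seteqP; split => w /=; [move/eqP|move=> ?; exact/eqP].
  by move=> w /= /not_implyP[_]; apply: contra_not_neq => ->; rewrite expr0n.
have vgt0 : 0 < v by rewrite lt_neqAle eq_sym vn0.
have s0 : Num.sqrt v != 0 by rewrite gt_eqF// sqrtr_gt0.
rewrite -[v in leRHS](sqr_sqrtr v0).
apply: le_trans (integral_sqr_normal_prob_le s0).
have msq : measurable_fun setT (fun x : R => (x ^+ 2)%:E).
  by apply/measurable_EFinP; exact: measurable_funX.
have mX' : measurable_fun setT (X : Omega -> measurableTypeR R) by exact: mX.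
pose Xm : {mfun Omega >-> measurableTypeR R} :=
  HB.pack (X : Omega -> measurableTypeR R) (isMeasurableFun.Build _ _ _ _ _ mX').
rewrite (_ : \int[normal_prob 0 (Num.sqrt v)]_x _ =
    \int[pushforward P Xm]_x (x ^+ 2)%:E)%E.
  by rewrite ge0_integral_pushforward// => x _; rewrite lee_fin sqr_ge0.
by apply: eq_measure_integral => A mA _; rewrite /= /pushforward PX.
Qed.

(* A negative [v] makes [Num.sqrt v = 0], and [normal_prob 0 0] is then the
   uniform law on [[0, 1]], which is not symmetric. *)
Lemma centered_gaussian_var_ge0 (R : realType) d (Omega : measurableType d)
    (P : probability Omega R) (X : Omega -> R) (v : R) :
  measurable_fun setT X -> centered_gaussian P X v ->
  centered_gaussian P (fun w => - X w) v -> 0 <= v.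
Proof.
move=> mX; rewrite /centered_gaussian; case: eqVneq => [->//|vn0 PX PNX].
rewrite leNgt; apply/negP => vlt0.
have s0 : Num.sqrt v = 0 by rewrite ler0_sqrtr// ltW.
have mA : measurable (`]0, 1] : set R) by [].
have U1 : normal_prob 0 (Num.sqrt v) `]0, 1] = 1%E :> \bar R.
  rewrite /normal_prob /normal_pdf s0 eqxx integral_indic//=.
  rewrite setIidr; last by apply: subset_itvr; rewrite bnd_simp.
  by rewrite lebesgue_measure_itv/= lte01 oppr0 adde0.
have mXA : measurable (X @^-1` `]0, 1]) by rewrite -[X in measurable X]setTI; exact: mX.
have mNXA : measurable ((fun w => - X w) @^-1` `]0, 1]).
  by rewrite -[X in measurable X]setTI; exact: measurableT_comp.
(* [X] and [- X] would each lie in []0, 1]] with probability one. These events are disjoint because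
   0 is excluded, so their union would have probability 2. *)
have := probability_le1 P (measurableU _ _ mXA mNXA).
rewrite measureU//; last first.
  apply/seteqP; split => w //=; rewrite !in_itv/= => -[/andP[? _] /andP[? _]]; lra.
by rewrite [X in (X + _)%E]PX// [X in (_ + X)%E]PNX// U1 -EFinD lee_fin; lra.
Qed.

(** * Wiener integrals of monotone decaying weights *)

Section fbm.
Context (R : realType) d (Omega : measurableType d) (P : probability Omega R).
Variables (H : R) (B : R -> Omega -> R).
Hypotheses (H01 : 0 < H <= 1) (fbmB : is_fBm P H B).

(** Nonnegativity of the covariance form is extracted from the Gaussian hypothesis itself: negating
    all coefficients negates the variable and leaves the quadratic form unchanged, so both signs are
    centered Gaussian with the same variance parameter. *)
Lemma fbm_lincomb_sqr_le (s : seq (R * R)) : all (fun p => 0 <= p.2) s ->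
  (\int[P]_w ((\sum_(p <- s) p.1 * B p.2 w) ^+ 2)%:E <=
   (8 * \sum_(p <- s) \sum_(q <- s) p.1 * q.1 * fbm_cov H p.2 q.2)%:E)%E.
Proof.
move=> s0; have [mB gB] := fbmB.
have ms : measurable_fun setT (fun w => \sum_(p <- s) p.1 * B p.2 w).
  by apply: measurable_sum => p; exact: measurable_funM.
apply: centered_gaussian_sqr_le => //; last exact: gB.
apply: (@centered_gaussian_var_ge0 _ _ _ P _ _ ms (gB s s0)).
have := gB [seq (- p.1, p.2) | p <- s].
rewrite all_map => /(_ s0).
congr (centered_gaussian P); last first.
  rewrite big_map; apply: eq_bigr => p _; rewrite big_map.
  by apply: eq_bigr => q _; rewrite mulrNN.
apply/funext => w; rewrite big_map -sumrN.
by apply: eq_bigr => p _; rewrite mulNr.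
Qed.

(* The coefficients are nonnegative, so it is enough to bound each covariance
   of two tails [B T - B (t i)] from above by the Cauchy-Schwarz product. *)
Lemma fbm_tails_sqr_le (I : Type) (r : seq I) (c t : I -> R) (T : R) :
  (forall i, 0 <= c i) -> (forall i, 0 <= t i <= T) -> 0 <= T ->
  (\int[P]_w ((\sum_(i <- r) c i * (B T w - B (t i) w)) ^+ 2)%:E <=
   (8 * (\sum_(i <- r) c i * (T - t i) `^ H) ^+ 2)%:E)%E.
Proof.
move=> c0 t0T T0.
pose s := [seq (c i, T) | i <- r] ++ [seq (- c i, t i) | i <- r].
have s0 : all (fun p => 0 <= p.2) s.
  rewrite all_cat !all_map; apply/andP; split; elim: (r) => //= i r' ->.
    by rewrite T0.
  by have /andP[->] := t0T i.
apply: le_trans (_ : (\int[P]_w ((\sum_(p <- s) p.1 * B p.2 w) ^+ 2)%:E <= _)%E).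
  rewrite le_eqVlt; apply/orP; left; apply/eqP; apply: eq_integral => w _.
  rewrite big_cat /= !big_map -big_split /=; congr ((_ ^+ 2)%:E).
  by apply: eq_bigr => i _; ring.
apply: le_trans (fbm_lincomb_sqr_le s0) _; rewrite lee_fin ler_wpM2l//.
rewrite expr2 mulr_suml big_cat /= !big_map -big_split /=.
apply: ler_sum => i _; rewrite !big_cat /= !big_map -!big_split /= mulr_sumr.
apply: ler_sum => j _.
have /andP[_ tiT] := t0T i; have /andP[_ tjT] := t0T j.
rewrite [leRHS]mulrACA.
apply: le_trans (ler_wpM2l (mulr_ge0 (c0 i) (c0 j)) (fbm_cov_tail_le H01 tiT tjT)).
by rewrite le_eqVlt; apply/orP; left; apply/eqP; ring.
Qed.

Lemma riemann_sum_dB_sqr_le (f : R -> R) (T c : R) (N : nat) :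
  0 < T -> 0 < c -> (0 < N)%N ->
  (forall s t, 0 <= s -> s <= t -> t <= T -> f s <= f t) ->
  (forall t, 0 <= t <= T -> 0 <= f t <= expR (- (c * (T - t)))) ->
  (\int[P]_w (riemann_sum_dB B f T N w ^+ 2)%:E <=
   (8 * (expR 1 / c `^ H) ^+ 2)%:E)%E.
Proof.
move=> T0 c0 N0 fnd fle; have /andP[H0 H1] := H01.
pose t (i : nat) : R := i%:R * T / N%:R.
have N0R : 0 < N%:R :> R by rewrite ltr0n.
have tN : t N = T by rewrite /t mulrAC divff ?mul1r ?gt_eqF.
have tnd i j : (i <= j)%N -> t i <= t j.
  by move=> ij; rewrite /t ler_pM2r ?invr_gt0// ler_pM2r// ler_nat.
have t0 i : 0 <= t i by rewrite divr_ge0 ?mulr_ge0// ltW.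
have tT i : (i <= N)%N -> t i <= T by move=> /tnd; rewrite tN.
have f0 i : (i <= N)%N -> 0 <= f (t i).
  by move=> iN; have /fle/andP[] : 0 <= t i <= T by rewrite t0 tT.
pose g i := f (t i).
(* Monotonicity of [f] gives the sign for positive indices; at index 0 the difference is [f 0]
   itself, which is nonnegative. *)
have w0 (i : 'I_N) : 0 <= bdiff g i.
  case: i => -[|i] iN /=; rewrite /bdiff ?subr0 ?f0// subr_ge0.
  by apply: fnd; rewrite ?tnd ?tT// ltnW.
have SE w : riemann_sum_dB B f T N w = \sum_(i < N) bdiff g i * (B T w - B (t i) w).
  by rewrite -{2}tN -(abel_summation g (fun i => B (t i) w)).
under eq_integral do rewrite SE.
have t0T (i : 'I_N) : 0 <= t i <= T by rewrite t0 tT// ltnW.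
apply: le_trans (fbm_tails_sqr_le _ w0 t0T (ltW T0)) _.
rewrite lee_fin ler_wpM2l// lerXn2r// ?nnegrE ?divr_ge0 ?expR_ge0 ?powR_ge0//.
  by apply: sumr_ge0 => i _; rewrite mulr_ge0 ?powR_ge0.
pose u i := T - t i.
(* Abel summation is undone with [- (u i)^H] in place of [B (t i)]; the terminal value vanishes
   because [u N = 0] and [H > 0]. *)
have -> : \sum_(i < N) bdiff g i * (T - t i) `^ H =
    \sum_(i < N) g i * (u i `^ H - u i.+1 `^ H).
  have uN : u N `^ H = 0 by rewrite /u tN subrr powR0 ?gt_eqF.
  have /= := abel_summation g (fun i => - (u i `^ H)) N; rewrite uN.
  under eq_bigr do rewrite opprK addrC.
  by move=> ->; apply: eq_bigr => i _; rewrite oppr0 add0r opprK.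
apply: le_trans (sum_expR_powR_le (u := u) H01 c0 _ _) => [|i iN|i iN].
- apply: ler_sum => i _; apply: ler_wpM2r; last by case/andP: (fle _ (t0T i)).
  rewrite subr_ge0; apply: ge0_ler_powR; rewrite ?nnegrE ?subr_ge0 ?tT// 1?ltnW//.
    exact: ltW.
  by rewrite lerD2l lerN2 tnd.
- by rewrite subr_ge0 tT.
- by rewrite lerD2l lerN2 tnd.
Qed.

(** A single Riemann sum [S] at [L^2] distance squared at most [V] from [X] is enough, since the
    bound [8 V] for [S] holds for every mesh. The constant is [18 = 2 * 1 + 2 * 8], from
    [X^2 <= 2 (X - S)^2 + 2 S^2]. *)
Lemma wiener_integral_sqr_le (f : R -> R) (T c : R) (X : Omega -> R) :
  0 < T -> 0 < c ->
  (forall s t, 0 <= s -> s <= t -> t <= T -> f s <= f t) ->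
  (forall t, 0 <= t <= T -> 0 <= f t <= expR (- (c * (T - t)))) ->
  is_wiener_integral P B f T X ->
  (\int[P]_w (X w ^+ 2)%:E <= (18 * (expR 1 / c `^ H) ^+ 2)%:E)%E.
Proof.
move=> T0 c0 fnd fle [mX cvX]; have [mB _] := fbmB.
set V := (expR 1 / c `^ H) ^+ 2.
have V0 : 0 < V by rewrite exprn_gt0// divr_gt0 ?expR_gt0 ?powR_gt0.
(* The maximum with 1 keeps the number of subintervals positive. *)
have [N0 XN0] := cvX V V0; set N := maxn N0 1.
have XN := XN0 N (leq_maxl _ _).
have SN := @riemann_sum_dB_sqr_le f T c N T0 c0 (leq_maxr _ _) fnd fle.
set S := riemann_sum_dB B f T N in XN SN.
have mS : measurable_fun setT S.
  apply: measurable_sum => i; apply: measurable_funM => //.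
  exact: measurable_funB.
have mD : measurable_fun setT (fun w => ((X w - S w) ^+ 2)%:E).
  by apply/measurable_EFinP; apply: measurable_funX; exact: measurable_funB.
have mS2 : measurable_fun setT (fun w => (S w ^+ 2)%:E).
  by apply/measurable_EFinP; exact: measurable_funX.
apply: (@le_trans _ _ (\int[P]_w (2%:E * ((X w - S w) ^+ 2)%:E + 2%:E * (S w ^+ 2)%:E))%E).
  apply: ge0_le_integral => //.
  - by move=> w _; rewrite lee_fin sqr_ge0.
  - by apply/measurable_EFinP; exact: measurable_funX.
  - by apply: emeasurable_funD; exact: measurable_funeM.
  - move=> w _; rewrite -!EFinM -EFinD lee_fin.
    (* The two sides differ by exactly [(X - 2 S)^2]. *)
    have := sqr_ge0 (X w - S w *+ 2); lra.
rewrite ge0_integralD//; last 4 first.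
- by move=> w _; rewrite -EFinM lee_fin mulr_ge0 ?sqr_ge0.
- exact: measurable_funeM.
- by move=> w _; rewrite -EFinM lee_fin mulr_ge0 ?sqr_ge0.
- exact: measurable_funeM.
rewrite !ge0_integralZl//; try by move=> w _; rewrite lee_fin sqr_ge0.
apply: (@le_trans _ _ (2%:E * V%:E + 2%:E * (8 * V)%:E)%E).
  by apply: leeD; apply: lee_wpmul2l; rewrite ?lee_fin.
by rewrite -!EFinM -EFinD lee_fin; lra.
Qed.

End fbm.

(** * The weights [exp (- lambda * \int_t^T a)] *)

(** Composing with the projection of the line onto [[a, b]] yields a globally nondecreasing function
    that agrees with [f] on the interval. *)
Lemma nondecreasing_on_itv_measurable (R : realType) (a b : R) (f : R -> R) :
  a <= b -> (forall s t, a <= s -> s <= t -> t <= b -> f s <= f t) ->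
  measurable_fun `[a, b] f.
Proof.
move=> ab fnd; pose clamp (t : R) := Num.min b (Num.max a t).
apply: (eq_measurable_fun (f \o clamp)) => [t|].
  rewrite inE/= in_itv/= => /andP[at_ tb] /=.
  by rewrite /clamp max_r// min_r.
apply: nondecreasing_measurable => // s t st; apply: fnd.
- by rewrite le_min ab le_max lexx.
- by rewrite le_min ge_min lexx/= ge_min ge_max !le_max lexx st /= !orbT.
- by rewrite ge_min lexx.
Qed.

Lemma integral_expR_itv (R : realType) (c T : R) : 0 < c -> 0 < T ->
  (\int[lebesgue_measure]_(t in `[0%R, T]) (expR (- (c * (T - t))))%:E =
   ((1 - expR (- (c * T))) / c)%:E)%E.
Proof.
move=> c0 T0; pose F t := expR (- (c * (T - t))) / c.
have dF (x : R) : is_derive x 1 F (expR (- (c * (T - x)))).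
  apply: is_derive_eq; rewrite /GRing.scale /=; field.
  by rewrite gt_eqF.
have cF : continuous F.
  by move=> x; apply: differentiable_continuous; apply/derivable1_diffP; case: (dF x).
rewrite (@continuous_FTC2 _ _ F)//.
- by rewrite -EFinB /F subrr subr0 mulr0 oppr0 expR0 mulrBl.
- apply: continuous_subspaceT => x.
  apply: (@continuous_comp _ _ _ (fun t => - (c * (T - t))) expR); last exact: continuous_expR.
  apply: cvgN; apply: cvgM; first exact: cvg_cst.
  by apply: cvgB; [exact: cvg_cst|exact: cvg_id].
- split; last 2 first.
  + exact: cvg_at_right_filter (cF 0).
  + exact: cvg_at_left_filter (cF T).
  by move=> x _; case: (dF x).
- by move=> x _; rewrite derive1E; have [_ ->] := dF x.
Qed.

Lemma Rintegral_mul_decay_le (R : realType) (h f : R -> R) (T c M : R) :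
  0 < T -> 0 < c -> measurable_fun `[0, T] h ->
  {ae (@lebesgue_measure R), forall t : R, t \in `[0, T]%R -> `|h t| <= M} ->
  (forall s t, 0 <= s -> s <= t -> t <= T -> f s <= f t) ->
  (forall t, 0 <= t <= T -> 0 <= f t <= expR (- (c * (T - t)))) ->
  `|\int[lebesgue_measure]_(t in `[0, T]) (h t * f t)| <= `|M| / c.
Proof.
move=> T0 c0 mh hM fnd fle.
have mf := nondecreasing_on_itv_measurable (ltW T0) fnd.
have mhf : measurable_fun `[0, T] (fun t => (h t * f t)%:E).
  by apply/measurable_EFinP; exact: measurable_funM.
have me : measurable_fun `[0, T] (fun t => expR (- (c * (T - t)))).
  apply: nondecreasing_on_itv_measurable; first exact: ltW.
  by move=> s t _ st _; rewrite ler_expR lerN2 ler_pM2l// lerD2l lerN2.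
(* The bound is proved for the extended-real integral; being finite, it excludes infinite values, so
   passing to the real-valued integral loses nothing. *)
suff : (`|\int[lebesgue_measure]_(t in `[0%R, T]) (h t * f t)%:E| <= (`|M| / c)%:E)%E.
  by rewrite /Rintegral; case: (integral _ _ _) => [r||] //=; rewrite ?lee_fin// leye_eq.
apply: le_trans (le_abse_integral lebesgue_measure (measurable_itv _) mhf) _.
apply: (@le_trans _ _ (\int[lebesgue_measure]_(t in `[0%R, T]) (`|M|%:E * (expR (- (c * (T - t))))%:E))%E).
  apply: ae_ge0_le_integral => //.
  - exact: measurableT_comp.
  - by apply: measurable_funeM; exact/measurable_EFinP.
  - case: hM => Z [mZ Z0 hZ]; exists Z; split=> //; apply: subset_trans hZ => t.
    apply: contra_not => htM tT.
    have /andP[f0 fe] : 0 <= f t <= expR (- (c * (T - t))).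
      by apply: fle; move: tT; rewrite /= in_itv.
    rewrite -EFinM lee_fin normrM (ger0_norm f0) ler_pM//.
    by apply: le_trans (htM tT) _; exact: ler_norm.
rewrite ge0_integralZl//; last exact/measurable_EFinP.
rewrite integral_expR_itv// -EFinM lee_fin ler_wpM2l// ler_pdivrMr//.
by rewrite mulVf ?gt_eqF// gerBl expR_ge0.
Qed.

Section tail_integral.
Variables (R : realType) (T a0 a1 : R) (a : R -> R).
Hypotheses (ma : measurable_fun `[0, T] a) (a0_gt0 : 0 < a0).
Hypothesis ha : forall t, t \in `[0, T] -> a0 <= a t <= a1.
Notation mu := (@lebesgue_measure R).

Let ha_itv t s : 0 <= t -> `[t, T]%classic s -> a0 <= a s <= a1.
Proof.
move=> t0; rewrite /= in_itv/= => /andP[ts sT].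
by apply: ha; rewrite in_itv/= sT (le_trans t0 ts).
Qed.

Let sub_itv (t : R) : 0 <= t -> `[t, T] `<=` `[0, T].
Proof. by move=> t0; apply: subset_itvr; rewrite bnd_simp. Qed.

Let integrable_a t : 0 <= t -> mu.-integrable `[t, T] (EFin \o a).
Proof.
move=> t0; apply: measurable_bounded_integrable => //.
- by rewrite /= lebesgue_measure_itv/=; case: ifPn => _; rewrite -?EFinB ltry.
- exact: measurable_funS (sub_itv t0) ma.
exists a1; split; first exact: num_real.
move=> x a1x s /(ha_itv t0)/andP[a0s sa1].
by rewrite /= ger0_norm ?(le_trans (ltW a0_gt0))// (le_trans sa1)// ltW.
Qed.

Lemma tail_integral_ge t : 0 <= t <= T ->
  a0 * (T - t) <= \int[mu]_(s in `[t, T]) a s.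
Proof.
move=> /andP[t0 tT].
apply: (@le_trans _ _ (\int[mu]_(s in `[t, T]) a0)).
  rewrite Rintegral_cst//= lebesgue_measure_itv/= lte_fin.
  (* In the degenerate case [t = T] the interval has measure zero and both factors [T - t]
     vanish. *)
  case: ltP => [_|Tt]; first by rewrite -EFinB.
  by rewrite (@le_anti _ _ t T) ?tT// subrr.
apply: le_Rintegral => //; [|exact: integrable_a|by move=> s /(ha_itv t0)/andP[]].
apply: measurable_bounded_integrable => //.
  by rewrite /= lebesgue_measure_itv/=; case: ifPn => _; rewrite -?EFinB ltry.
exists `|a0|; split; first exact: num_real.
by move=> x a0x s _; exact: ltW.
Qed.

(** Since [a] is positive on [[0, T]], shrinking the domain cannot increase the integral. This makes
    the weights nondecreasing in time. *)
Lemma tail_integral_nonincreasing s t : 0 <= s -> s <= t ->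
  \int[mu]_(x in `[t, T]) a x <= \int[mu]_(x in `[s, T]) a x.
Proof.
move=> s0 st; have t0 := le_trans s0 st.
apply: fine_le; [exact: integrable_fin_num (integrable_a t0)|
  exact: integrable_fin_num (integrable_a s0)|].
apply: ge0_subset_integral => //.
- by apply/measurable_EFinP; exact: measurable_funS (sub_itv s0) ma.
- by move=> x /(ha_itv s0)/andP[a0x _]; rewrite lee_fin (le_trans (ltW a0_gt0)).
- by apply: subset_itvr; rewrite bnd_simp.
Qed.

End tail_integral.

(** Trades decay of order [q] for the weaker order [p], paying a constant that depends only on a
    lower bound [x] of [y]. It serves with [x = lambda 1], [y = lambda n] and [q = 2 * Hu]. *)
Lemma powRB_powR_le (R : realType) (p q x y : R) : p <= q -> 0 < x -> x <= y ->
  x `^ (q - p) * y `^ p <= y `^ q.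
Proof.
move=> pq x0 xy; have y0 := lt_le_trans x0 xy.
rewrite -[q in leRHS](subrK p) [leRHS]powRD ?(gt_eqF y0) ?implybT//.
rewrite ler_wpM2r ?powR_ge0//; apply: ge0_ler_powR; rewrite ?nnegrE ?subr_ge0//;
  exact: ltW.
Qed.

Unset Implicit Arguments.

Theorem theorem4p2 (R : realType) (R0 T : R) (a : R -> R) (a0 a1 : R)
  (h : R -> R) (Hu : R)
  (d : measure_display) (Omega : measurableType d) (P : probability Omega R)
  (B : R -> Omega -> R) :
  0 < R0 -> 0 < T ->
  measurable_fun `[0, T] a ->
  0 < a0 -> (forall t, t \in `[0, T] -> a0 <= a t <= a1) ->
  0 < Hu < 1 -> is_fBm P Hu B ->
  measurable_fun `[0, T] h ->
  (exists M : R, {ae (@lebesgue_measure R), forall t : R, t \in `[0, T]%R -> `|h t| <= M}) ->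
  {ae (@lebesgue_measure R), forall t : R, t \in `[0, T]%R -> 0 <= h t} ->
  (0%E < (@lebesgue_measure R) [set t : R | t \in `[0, T]%R /\ (h t != 0)%R])%E ->
  let lambda := fun n : nat => (n%:R * pi / R0) ^+ 2 in
  let p := Order.min (2 * Hu) 1 in
  let E := fun (n : nat) (tau : R) =>
    expR (- lambda n * \int[lebesgue_measure]_(s in `[tau, T]) a s) in
  exists C : R, 0 < C /\
    forall n : nat, (1 <= n)%N ->
      `| \int[lebesgue_measure]_(tau in `[0, T]) (h tau * E n tau) | <= C / lambda n /\
      forall X : Omega -> R, is_wiener_integral P B (E n) T X ->
        (\int[P]_w ((X w ^+ 2)%:E) <= (C / lambda n `^ p)%:E)%E.
Proof.
move=> R0_gt0 T0 ma a0_gt0 ha /andP[H0 H1] fbmB mh [M hM] _ _ lambda p E.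
have l1 : 0 < lambda 1%N by rewrite exprn_gt0// divr_gt0// mulr_gt0 ?pi_gt0.
have l1n n : (1 <= n)%N -> lambda 1%N <= lambda n.
  move=> n1; rewrite lerXn2r ?nnegrE ?divr_ge0 ?mulr_ge0 ?pi_ge0 ?(ltW R0_gt0)//.
  by rewrite ler_pM2r ?invr_gt0// ler_pM2r ?pi_gt0// ler_nat.
have H01 : 0 < Hu <= 1 by rewrite H0 ltW.
(* [C1] and [C2] come from the two decay estimates at rate [c = lambda n * a0]. In [C2] the power of
   [lambda 1] is the price of lowering the exponent from [2 * Hu] to [p]. Their sum serves both
   inequalities. *)
pose C1 := `|M| / a0.
pose C2 := 18 * expR 1 ^+ 2 / (a0 `^ (2 * Hu) * lambda 1%N `^ (2 * Hu - p)).
have C1_ge0 : 0 <= C1 by rewrite divr_ge0// ltW.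
have C2_gt0 : 0 < C2.
  by rewrite divr_gt0 ?mulr_gt0 ?exprn_gt0 ?expR_gt0 ?powR_gt0.
exists (C1 + C2); split; first by rewrite ltr_wpDl.
move=> n n1; have ln : 0 < lambda n by exact: lt_le_trans l1 (l1n n n1).
have c0 : 0 < lambda n * a0 by rewrite mulr_gt0.
have End s t : 0 <= s -> s <= t -> t <= T -> E n s <= E n t.
  move=> s0 st tT; rewrite ler_expR !mulNr lerN2 ler_pM2l//.
  exact: (tail_integral_nonincreasing ma a0_gt0 ha).
have Ele t : 0 <= t <= T -> 0 <= E n t <= expR (- (lambda n * a0 * (T - t))).
  move=> t0T; rewrite expR_ge0 ler_expR mulNr lerN2 -mulrA ler_pM2l//.
  exact: (tail_integral_ge ma a0_gt0 ha).
split=> [|X XE].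
  apply: le_trans (Rintegral_mul_decay_le T0 c0 mh hM End Ele) _.
  by rewrite invfM mulrCA mulrC ler_pM2r ?invr_gt0// lerDl ltW.
apply: le_trans (wiener_integral_sqr_le H01 fbmB T0 c0 End Ele XE) _.
rewrite lee_fin (@le_trans _ _ (C2 / lambda n `^ p))//; last first.
  by rewrite ler_pM2r ?invr_gt0 ?powR_gt0// lerDr.
have p2H : p <= 2 * Hu by rewrite ge_min lexx.
rewrite expr_div_n mulrA /C2 -[leRHS]mulrA -invfM -(mulrA (a0 `^ _)).
rewrite ler_wpM2l ?mulr_ge0 ?exprn_ge0 ?expR_ge0// lef_pV2 ?posrE; last 2 first.
- by rewrite exprn_gt0// powR_gt0.
- by rewrite !mulr_gt0 ?powR_gt0.
rewrite -powR_mulrn ?powR_ge0// -powRrM [Hu * _]mulrC (mulrC (lambda n)).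
rewrite (powRM _ (ltW a0_gt0) (ltW ln)) ler_wpM2l ?powR_ge0//.
by apply: powRB_powR_le; rewrite ?l1n.
Qed.
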